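(* Let $n=2^k$ and $v=2^m+1$ with $k,m$ nonnegative integers and $v>n$. Put $\alpha=\frac{2v+n-2}{n}$. Then $\alpha\in\mathbb{Z}$, and the function $$z(x)=x^{\frac{n\alpha}{2}}J_\alpha\Big(\frac{2}{n}x^{\frac n2}\Big)$$ is a solution on $x>0$ of the ordinary differential equation $$x z''-(2v+n-3)z'+x^{n-1}z=0 .$$
   Context: $J_\alpha$ denotes the Bessel function of the first kind of order $\alpha$, $J_\alpha(x)=\sum_{j=0}^\infty \frac{(-1)^j}{j!\,\Gamma(j+\alpha+1)}\left(\frac{x}{2}\right)^{2j+\alpha}$. *)

(* Defs.v *)
From Stdlib Require Export Reals Factorial.
From Coquelicot Require Export Coquelicot.
Open Scope R_scope.

(* s (s+1) ... (s+N-1) *)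
Fixpoint rising (s : R) (N : nat) : R :=
  match N with
  | O => 1
  | S N' => rising s N' * (s + INR N')
  end.

(* Convergent for s > 0 only. *)
Definition Euler_integral (s : R) : R :=
  RInt_gen (fun t => Rpower t (s - 1) * exp (- t))
    (at_right 0) (Rbar_locally p_infty).

(* Extension to the real line by Gamma(s) = Gamma(s+N) / (s (s+1) ... (s+N-1)),
   where N is the least natural number with s + N > 0; for s > 0 we have N = 0
   and this is Euler's integral.  At the poles s = 0, -1, -2, ... the value
   is 0 (as [/ 0 = 0]), so that [/ Gamma s = 0] there, which is the usual
   convention for 1/Gamma. *)
Definition Gamma (s : R) : R :=
  let N := Z.to_nat (up (- s)) in
  Euler_integral (s + INR N) / rising s N.

(* The powers of x/2 are real powers, so this is meaningful for x > 0. *)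
Definition BesselJ (alpha x : R) : R :=
  Series (fun j : nat =>
    (-1) ^ j / (INR (fact j) * Gamma (INR j + alpha + 1))
    * Rpower (x / 2) (2 * INR j + alpha)).

(* Main.v *)
Require Import Defs.
From Stdlib Require Import Reals.
From Coquelicot Require Import Coquelicot.
From Stdlib Require Import Lra Lia.
Open Scope R_scope.

(** Since [v > n] forces [k <= m], the index is
    [alpha = 2 * 2^(m-k) + 1], a natural number [a], and
    [n * a = 2 v + n - 2]; the equation to prove is therefore
    [x z'' - (n a - 1) z' + x^(n-1) z = 0].

    For a natural index the Bessel function is elementary up to an entire
    function: [J_a(x) = (x/2)^a C_a((x/2)^2)], where
    [C_a(y) = sum_j (-y)^j / (j! (j+a)!)] is the Bessel-Clifford function
    ([BesselJ_nat]).  Substituting, [z(x) = n^(-a) x^(na) C_a(x^n / n^2)] for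
    [x > 0], so that only natural powers remain.  The recurrence between
    successive coefficients of [C_a] says exactly that
    [y C'' + (a+1) C' + C = 0] ([clifford_ode]), and the change of variable
    [y = x^n / n^2] turns this into the required equation
    ([ode_of_clifford_subst]).

    The coefficients of the Bessel series involve [Gamma (j + a + 1)], an
    improper integral whose value [(j + a)!] comes from integrating by parts
    ([is_RInt_gen_pow_mul_exp_opp], [Gamma_nat]). *)

(** * The Gamma function at positive integers *)

(** Induction on [N]: [t^(N+1) e^(-t)] is a constant times the product of
    [s^N e^(-s)] and [s e^(-s)] at [s = t/2], so one factor at a time tends
    to 0. *)
Lemma is_lim_pow_mul_exp_opp (N : nat) :
  is_lim (fun t => t ^ N * exp (- t)) p_infty 0.
Proof.
  assert (base : is_lim (fun t => exp (- t)) p_infty 0).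
  { apply (is_lim_comp exp (fun t => - t) p_infty 0 m_infty).
    - exact is_lim_exp_m.
    - exact (is_lim_opp (fun t => t) p_infty p_infty (is_lim_id p_infty)).
    - exists 0; easy. }
  assert (half : is_lim (fun t => t / 2) p_infty p_infty).
  { apply (is_lim_ext (fun t => / 2 * t)); [intros; field|].
    replace p_infty with (Rbar_mult (/ 2) p_infty) at 2.
    - apply is_lim_scal_l, is_lim_id.
    - apply is_Rbar_mult_unique, is_Rbar_mult_sym, is_Rbar_mult_p_infty_pos.
      simpl; lra. }
  assert (linear : is_lim (fun t => t * exp (- t)) p_infty 0).
  { apply (is_lim_ext_loc (fun t => / (exp t / t))).
    - exists 0. intros t ht. rewrite exp_Ropp. field.
      split; [apply Rgt_not_eq, exp_pos | lra].
    - exact (is_lim_inv _ _ _ is_lim_div_exp_p ltac:(easy)). }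
  induction N as [|N IHN].
  - apply (is_lim_ext (fun t => exp (- t))); [intros; simpl; ring | exact base].
  - apply (is_lim_ext (fun t => 2 ^ S N *
      (((t / 2) ^ N * exp (- (t / 2))) * ((t / 2) * exp (- (t / 2)))))).
    + intros t.
      replace (exp (- t)) with (exp (- (t / 2)) * exp (- (t / 2)))
        by (rewrite <- exp_plus; f_equal; field).
      replace (t ^ S N) with (2 ^ S N * (t / 2) ^ S N)
        by (rewrite <- Rpow_mult_distr; f_equal; field).
      simpl; ring.
    + replace (Finite 0) with (Rbar_mult (2 ^ S N) (Rbar_mult 0 0))
        by (simpl; f_equal; ring).
      apply is_lim_scal_l.
      apply is_lim_mult; [| |easy].
      * apply (is_lim_comp (fun t => t ^ N * exp (- t)) _ _ _ p_infty);
          [exact IHN | exact half | exists 0; easy].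
      * apply (is_lim_comp (fun t => t * exp (- t)) _ _ _ p_infty);
          [exact linear | exact half | exists 0; easy].
Qed.

(** The fundamental theorem of calculus on the open half-line.  As [F] is
    differentiable on all of [R], its limit at [0+] is [F 0]. *)
Lemma is_RInt_gen_derivative (F f : R -> R) (l : R) :
  (forall t, is_derive F t (f t)) -> (forall t, ex_derive f t) ->
  is_lim F p_infty l ->
  is_RInt_gen f (at_right 0) (Rbar_locally p_infty) (l - F 0).
Proof.
  intros hF hf hinf.
  assert (hD : forall t, Derive F t = f t)
    by (intros t; apply is_derive_unique, hF).
  apply (is_RInt_gen_ext (Derive F)).
  { apply filter_forall. intros ab t _. apply hD. }
  apply is_RInt_gen_Derive; [| | | exact hinf].
  - apply filter_forall. intros ab t _. eexists; apply hF.
  - apply filter_forall. intros ab t _.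
    apply (continuous_ext f); [intros; symmetry; apply hD |].
    apply (ex_derive_continuous f), hf.
  - apply (filterlim_filter_le_1 (G := at_right 0) (F := locally 0));
      [apply filter_le_within |].
    apply (ex_derive_continuous F). eexists; apply hF.
Qed.

(** Integration by parts in the form of a sum: the derivative
    [t^(N+1) e^(-t) - (N+1) t^N e^(-t)] of [- t^(N+1) e^(-t)] has integral 0, and
    adding [N+1] times the integral known by induction gives the next one.
    This also yields the convergence of the integral at each step. *)
Lemma is_RInt_gen_pow_mul_exp_opp (N : nat) :
  is_RInt_gen (fun t => t ^ N * exp (- t))
    (at_right 0) (Rbar_locally p_infty) (INR (fact N)).
Proof.
  assert (lim : forall M, is_lim (fun t => - (t ^ M * exp (- t))) p_infty 0).
  { intros M. replace (Finite 0) with (Rbar_opp 0) by (simpl; f_equal; ring).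
    apply is_lim_opp, is_lim_pow_mul_exp_opp. }
  induction N as [|N IHN].
  - replace (INR (fact 0)) with (0 - - (0 ^ 0 * exp (- 0)))
      by (rewrite Ropp_0, exp_0; simpl; ring).
    apply (is_RInt_gen_derivative (fun t => - (t ^ 0 * exp (- t)))); [| | apply lim].
    + intros t. auto_derive; [easy | simpl; ring].
    + intros t. auto_derive; easy.
  - assert (parts : is_RInt_gen
      (fun t => t ^ S N * exp (- t) - INR (S N) * (t ^ N * exp (- t)))
      (at_right 0) (Rbar_locally p_infty) (0 - - (0 ^ S N * exp (- 0)))).
    { apply (is_RInt_gen_derivative (fun t => - (t ^ S N * exp (- t)))); [| | apply lim].
      - intros t. auto_derive; [easy |]. simpl; ring.
      - intros t. auto_derive; easy. }
    pose proof (is_RInt_gen_plus _ _ _ _ parts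
      (is_RInt_gen_scal _ (INR (S N)) _ IHN)) as total.
    replace (INR (fact (S N)))
      with (plus (0 - - (0 ^ S N * exp (- 0))) (scal (INR (S N)) (INR (fact N)))).
    + refine (is_RInt_gen_ext _ _ _ _ total).
      apply filter_forall. intros ab t _.
      change (t ^ S N * exp (- t) - INR (S N) * (t ^ N * exp (- t))
        + INR (S N) * (t ^ N * exp (- t)) = t ^ S N * exp (- t)).
      ring.
    + rewrite fact_simpl, mult_INR, pow_i by lia.
      change (0 - - (0 * exp (- 0)) + INR (S N) * INR (fact N)
        = INR (S N) * INR (fact N)).
      ring.
Qed.

Lemma Euler_integral_nat (N : nat) : Euler_integral (INR N + 1) = INR (fact N).
Proof.
  apply is_RInt_gen_unique.
  apply (is_RInt_gen_ext (fun t => t ^ N * exp (- t)));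
    [| apply is_RInt_gen_pow_mul_exp_opp].
  apply (Filter_prod _ _ _ (fun t => 0 < t) (fun t => 0 < t)).
  - exists (mkposreal 1 Rlt_0_1). easy.
  - exists 0. easy.
  - intros a b ha hb t [ht _]. simpl in ht.
    rewrite <- Rpower_pow.
    + f_equal. f_equal. ring.
    + revert ht. apply Rmin_case; intros; lra.
Qed.

(** The argument is positive, so the extension by the functional equation makes
    no shift and the value is Euler's integral itself. *)
Lemma Gamma_nat (N : nat) : Gamma (INR N + 1) = INR (fact N).
Proof.
  assert (shift : Z.to_nat (up (- (INR N + 1))) = 0%nat).
  { destruct (archimed (- (INR N + 1))) as [_ hup].
    pose proof (pos_INR N).
    assert (IZR (up (- (INR N + 1))) <= 0) as hle by lra.
    apply le_IZR in hle. lia. }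
  unfold Gamma. rewrite shift. simpl. rewrite Rplus_0_r, Euler_integral_nat. field.
Qed.

(** * The Bessel-Clifford function *)

Definition clifford_coef (a j : nat) : R :=
  (-1) ^ j / (INR (fact j) * INR (fact (j + a))).

Lemma clifford_coef_neq_0 (a j : nat) : clifford_coef a j <> 0.
Proof.
  unfold clifford_coef, Rdiv. apply Rmult_integral_contrapositive_currified.
  - apply pow_nonzero; lra.
  - apply Rinv_neq_0_compat, Rmult_integral_contrapositive_currified; apply INR_fact_neq_0.
Qed.

(** The coefficient of [y^j] in the differential equation of [clifford_ode]. *)
Lemma clifford_coef_S (a j : nat) :
  INR (S j) * (INR j + 1 + INR a) * clifford_coef a (S j) = - clifford_coef a j.
Proof.
  unfold clifford_coef. rewrite plus_Sn_m, !fact_simpl, !mult_INR, !S_INR, plus_INR.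
  pose proof (pos_INR j). pose proof (pos_INR a).
  pose proof (INR_fact_neq_0 j). pose proof (INR_fact_neq_0 (j + a)).
  simpl pow. field. repeat split; try easy; lra.
Qed.

Lemma CV_radius_clifford_coef (a : nat) : CV_radius (clifford_coef a) = p_infty.
Proof.
  apply CV_radius_infinite_DAlembert; [apply clifford_coef_neq_0 |].
  apply (is_lim_seq_le_le (fun _ => 0) _ (fun j => / INR (S j))).
  - intros j. split; [apply Rabs_pos |].
    pose proof (pos_INR j). pose proof (pos_INR a).
    pose proof (clifford_coef_S a j) as hrec. rewrite S_INR in hrec |- *.
    pose proof (clifford_coef_neq_0 a j).
    replace (clifford_coef a (S j) / clifford_coef a j)
      with (- (/ ((INR j + 1) * (INR j + 1 + INR a)))).
    + rewrite Rabs_Ropp, Rabs_pos_eq.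
      * apply Rinv_le_contravar; nra.
      * apply Rlt_le, Rinv_0_lt_compat; nra.
    + replace (clifford_coef a (S j))
        with (- clifford_coef a j / ((INR j + 1) * (INR j + 1 + INR a)))
        by (rewrite <- hrec; field; lra).
      field. repeat split; try easy; lra.
  - apply is_lim_seq_const.
  - apply (is_lim_seq_incr_1 (fun j => / INR j)).
    exact (is_lim_seq_inv _ _ is_lim_seq_INR ltac:(easy)).
Qed.

(** The two derivatives are introduced as power series, because the
    differential equation is checked on coefficients;
    [is_derive_clifford] and [is_derive_clifford'] justify the names. *)
Definition clifford (a : nat) : R -> R := PSeries (clifford_coef a).
Definition clifford' (a : nat) : R -> R := PSeries (PS_derive (clifford_coef a)).
Definition clifford'' (a : nat) : R -> R :=
  PSeries (PS_derive (PS_derive (clifford_coef a))).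

Lemma is_derive_clifford (a : nat) (y : R) :
  is_derive (clifford a) y (clifford' a y).
Proof.
  apply is_derive_PSeries. now rewrite CV_radius_clifford_coef.
Qed.

Lemma is_derive_clifford' (a : nat) (y : R) :
  is_derive (clifford' a) y (clifford'' a y).
Proof.
  apply is_derive_PSeries. now rewrite CV_radius_derive, CV_radius_clifford_coef.
Qed.

Lemma clifford_ode (a : nat) (y : R) :
  y * clifford'' a y + (INR a + 1) * clifford' a y + clifford a y = 0.
Proof.
  set (c := clifford_coef a).
  assert (conv : forall b, CV_radius b = p_infty -> ex_pseries b y).
  { intros b hb. apply CV_radius_inside. now rewrite hb. }
  pose proof (CV_radius_clifford_coef a) as r0. fold c in r0.
  pose proof (CV_radius_derive c) as r1. rewrite r0 in r1.
  pose proof (CV_radius_derive (PS_derive c)) as r2. rewrite r1 in r2.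
  assert (e2 : ex_pseries (PS_incr_1 (PS_derive (PS_derive c))) y)
    by apply ex_pseries_incr_1, conv, r2.
  assert (e1 : ex_pseries (PS_scal (INR a + 1) (PS_derive c)) y)
    by (apply ex_pseries_scal; [apply Rmult_comm | apply conv, r1]).
  unfold clifford'', clifford', clifford. fold c.
  rewrite <- PSeries_incr_1, <- PSeries_scal.
  rewrite <- !PSeries_plus.
  - rewrite <- (PSeries_const_0 y). apply PSeries_ext. intros j.
    pose proof (clifford_coef_S a j) as hrec. fold c in hrec.
    unfold PS_plus, PS_scal, PS_incr_1, PS_derive.
    unfold plus, scal; simpl; unfold mult; simpl.
    destruct j as [|j].
    + simpl in hrec |- *. unfold zero; simpl. lra.
    + change (match j with 0%nat => 1 | S _ => INR j + 1 end) with (INR (S j)).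
      rewrite !S_INR in hrec. rewrite !S_INR. lra.
  - apply ex_pseries_plus; easy.
  - apply conv, r0.
  - easy.
  - easy.
Qed.

(** The real powers [(x/2)^(2j+a)] have natural exponents, so they split as
    [(x/2)^a] times [((x/2)^2)^j]. *)
Lemma BesselJ_nat (a : nat) (x : R) : 0 < x ->
  BesselJ (INR a) x = (x / 2) ^ a * clifford a ((x / 2) ^ 2).
Proof.
  intros hx. unfold BesselJ, clifford, PSeries. rewrite <- Series_scal_l.
  apply Series_ext. intros j.
  rewrite <- plus_INR, Gamma_nat.
  replace (2 * INR j + INR a) with (INR (2 * j + a))
    by (rewrite plus_INR, mult_INR; simpl; ring).
  rewrite Rpower_pow by lra.
  rewrite pow_add, pow_mult. unfold clifford_coef. unfold Rdiv; ring.
Qed.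

(** * The change of variable *)

(** In terms of the Euler operator [theta = x d/dx]: with [u = x^n / n^2] one has
    [theta u = n u], hence [theta (x^N g(u)) = x^N (N g(u) + n u g'(u))].  The
    right-hand side has again the form [x^N h(u)], so the lemma can be
    iterated. *)
Lemma is_derive_pow_mul_comp (K : R) (N n : nat) (g : R -> R) (x g' : R) :
  (0 < n)%nat -> 0 < x ->
  let u := x ^ n / INR n ^ 2 in
  is_derive g u g' ->
  is_derive (fun x => K * x ^ N * g (x ^ n / INR n ^ 2)) x
    (K * x ^ N * (INR N * g u + INR n * u * g') / x).
Proof.
  intros hn hx u hg.
  assert (INR n <> 0) by (apply not_0_INR; lia).
  assert (hpow : forall p, is_derive (fun x => x ^ p) x (INR p * x ^ p / x)).
  { intros [|p]; auto_derive; try easy; simpl; field; lra. }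
  assert (hu : is_derive (fun x => x ^ n / INR n ^ 2) x (INR n * u / x)).
  { apply (is_derive_ext (fun x => / INR n ^ 2 * x ^ n)).
    { intros; unfold Rdiv; apply Rmult_comm. }
    replace (INR n * u / x) with (/ INR n ^ 2 * (INR n * x ^ n / x))
      by (unfold u; field; split; [easy | lra]).
    apply is_derive_scal, hpow. }
  apply (is_derive_ext (fun x => K * (x ^ N * g (x ^ n / INR n ^ 2)))).
  { intros; simpl; ring. }
  replace (K * x ^ N * (INR N * g u + INR n * u * g') / x)
    with (K * ((INR N * x ^ N / x) * g u + x ^ N * (INR n * u / x * g')))
    by (field; lra).
  apply is_derive_scal.
  apply (is_derive_mult (fun x => x ^ N) (fun x => g (x ^ n / INR n ^ 2)));
    [apply hpow | | apply Rmult_comm].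
  exact (is_derive_comp g (fun x => x ^ n / INR n ^ 2) x _ _ hg hu).
Qed.

(** Multiplied by [x], the equation reads
    [theta^2 z - n a theta z + n^2 u z = 0].  Applying the Euler operator twice
    by [is_derive_pow_mul_comp] to [K x^(na) C_a(u)], the left-hand side becomes
    [K x^(na) n^2 u] times the left-hand side of [clifford_ode] at [u]. *)
Lemma ode_of_clifford_subst (K : R) (a n : nat) (z : R -> R) (x : R) :
  (0 < n)%nat ->
  (forall x, 0 < x -> z x = K * x ^ (n * a) * clifford a (x ^ n / INR n ^ 2)) ->
  0 < x ->
  ex_derive z x /\ ex_derive_n z 2 x /\
  x * Derive_n z 2 x - (INR n * INR a - 1) * Derive z x + x ^ (n - 1) * z x = 0.
Proof.
  intros hn hz hx.
  (* [x z'(x) = K x^(na) theta(u)] *)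
  set (theta := fun u => INR (n * a) * clifford a u + INR n * u * clifford' a u).
  set (theta' := fun u => INR (n * a) * clifford' a u
    + (INR n * clifford' a u + INR n * u * clifford'' a u)).
  assert (htheta : forall u, is_derive theta u (theta' u)).
  { intros u. apply @is_derive_plus.
    - apply is_derive_scal, is_derive_clifford.
    - apply (is_derive_mult (fun u => INR n * u) (clifford' a));
        [| apply is_derive_clifford' | apply Rmult_comm].
      auto_derive; [easy | ring]. }
  assert (near : forall y, 0 < y -> locally y (fun t => 0 < t)).
  { intros y hy. apply (open_gt 0 y hy). }
  set (z1 := fun x => K * x ^ (n * a) * theta (x ^ n / INR n ^ 2) / x).
  assert (hz1 : forall x, 0 < x -> is_derive z x (z1 x)).
  { intros y hy.
    eapply is_derive_ext_loc; [| apply is_derive_pow_mul_comp, is_derive_clifford; easy].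
    apply (filter_imp (fun t => 0 < t)); [| now apply near].
    intros t ht. symmetry. now apply hz. }
  set (u := x ^ n / INR n ^ 2).
  set (z2 := K * x ^ (n * a)
    * (INR (n * a) * theta u + INR n * u * theta' u - theta u) / x ^ 2).
  assert (hz2 : is_derive (Derive z) x z2).
  { apply (is_derive_ext_loc z1).
    { apply (filter_imp (fun t => 0 < t)); [| now apply near].
      intros t ht. symmetry. now apply is_derive_unique, hz1. }
    pose proof (is_derive_pow_mul_comp K (n * a) n theta x _ hn hx (htheta u)) as hnum.
    pose proof (is_derive_div _ (fun x => x) x _ 1 hnum (is_derive_id x) ltac:(lra)) as hdiv.
    replace z2 with ((K * x ^ (n * a) * (INR (n * a) * theta u + INR n * u * theta' u)
      / x * x - K * x ^ (n * a) * theta u * 1) / x ^ 2).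
    - exact hdiv.
    - unfold z2. field. lra. }
  split; [eexists; now apply hz1 | split; [now exists z2 |]].
  change (Derive_n z 2 x) with (Derive (Derive z) x).
  rewrite (is_derive_unique _ _ _ hz2), (is_derive_unique _ _ _ (hz1 x hx)), (hz x hx).
  assert (INR n <> 0) by (apply not_0_INR; lia).
  replace (x ^ (n - 1)) with (INR n ^ 2 * u / x).
  2:{ unfold u. replace (x ^ n) with (x * x ^ (n - 1)).
      - field. split; [easy | lra].
      - rewrite tech_pow_Rmult. f_equal. lia. }
  unfold z1, z2. fold u. unfold theta, theta'. rewrite mult_INR.
  transitivity (K * x ^ (n * a) * (INR n ^ 2 * u) / x
    * (u * clifford'' a u + (INR a + 1) * clifford' a u + clifford a u)).
  - field. lra.
  - rewrite clifford_ode. ring.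
Qed.

(** * The differential equation *)

Theorem mainTheorem2 (k m n v : nat)
  (hn : n = (2 ^ k)%nat) (hv : v = (2 ^ m + 1)%nat) (hnv : (n < v)%nat) :
  let alpha : R := (2 * INR v + INR n - 2) / INR n in
  let z : R -> R := fun x =>
    Rpower x (INR n * alpha / 2)
    * BesselJ alpha (2 / INR n * Rpower x (INR n / 2)) in
  (exists a : Z, alpha = IZR a) /\
  (forall x : R, 0 < x ->
     ex_derive z x /\ ex_derive_n z 2 x /\
     x * Derive_n z 2 x - (2 * INR v + INR n - 3) * Derive z x
       + x ^ (n - 1) * z x = 0).
Proof.
  intros alpha z.
  assert (npos : (0 < n)%nat) by (rewrite hn; apply Nat.neq_0_lt_0, Nat.pow_nonzero; lia).
  assert (Rnpos : 0 < INR n) by now apply lt_0_INR.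
  assert (hkm : (k <= m)%nat).
  { apply (Nat.pow_le_mono_r_iff 2); lia. }
  set (a := (2 * 2 ^ (m - k) + 1)%nat).
  assert (hna : INR n * INR a = 2 * INR v + INR n - 2).
  { assert (hpow : (2 ^ m = n * 2 ^ (m - k))%nat).
    { rewrite hn, <- Nat.pow_add_r. f_equal. lia. }
    rewrite hv, hpow. unfold a. rewrite !plus_INR, !mult_INR. simpl. ring. }
  assert (halpha : alpha = INR a).
  { unfold alpha. rewrite <- hna. field. lra. }
  split.
  { exists (Z.of_nat a). now rewrite <- INR_IZR_INZ. }
  intros x hx.
  replace (2 * INR v + INR n - 3) with (INR n * INR a - 1) by lra.
  apply (ode_of_clifford_subst (/ INR n ^ a)); [easy | | easy].
  clear x hx. intros x hx. unfold z. rewrite halpha.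
  (* Both real powers of x are natural powers of [s = x^(n/2)], and [s^2 = x^n]. *)
  set (s := Rpower x (INR n / 2)).
  assert (spos : 0 < s) by apply exp_pos.
  assert (hs : s ^ 2 = x ^ n).
  { unfold s. rewrite <- !Rpower_pow by (easy || apply exp_pos).
    rewrite Rpower_mult. f_equal. simpl. field. }
  replace (Rpower x (INR n * INR a / 2)) with (s ^ a).
  2:{ unfold s. rewrite <- Rpower_pow by apply exp_pos.
      rewrite Rpower_mult. f_equal. field. }
  rewrite BesselJ_nat by (apply Rmult_lt_0_compat; [apply Rdiv_lt_0_compat |]; lra).
  replace (2 / INR n * s / 2) with (s / INR n) by (field; lra).
  replace ((s / INR n) ^ 2) with (x ^ n / INR n ^ 2) by (rewrite <- hs; field; lra).
  rewrite pow_mult, <- hs, <- pow_mult.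
  replace (2 * a)%nat with (a + a)%nat by lia.
  unfold Rdiv at 1. rewrite pow_add, Rpow_mult_distr, pow_inv. ring.
Qed.
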